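(* Let $D$ be any distribution supported on $[0,1]$ with mean $\mu$ and variance $\sigma^2$, and $\epsilon>0$. The estimator described in the context returns an unbiased estimate $\hat\mu$ of $\mu$ with $\sqrt{\mathbb{E}[(\hat\mu-\mu)^2]}\le\sqrt{2.58}\,\epsilon$, and its expected number of samples is $5\frac{\sigma^2}{\epsilon^2}+\frac2\epsilon$.
   Context: Estimator (integer rounding ignored): set $T_1=1/\epsilon$; draw i.i.d. $X_1,\dots,X_{T_1}\sim D$; compute $\tilde\mu=\frac1{T_1}\sum_{i=1}^{T_1}X_i$ and $\tilde\sigma^2=\frac1{T_1-1}\sum_{i=1}^{T_1}(X_i-\tilde\mu)^2$; set $T_2=\frac1\epsilon+5\frac{\tilde\sigma^2}{\epsilon^2}$; draw $T_2$ fresh samples $X_{T_1+1},\dots,X_{T_1+T_2}$ and return $\hat\mu=\frac1{T_2}\sum_{i=T_1+1}^{T_1+T_2}X_i$.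
   Formalization: The expected number of samples is stated for the unrounded 1/ε + T_2 and only for ε < 1, since for ε ≥ 1 the sample variance (division by T_1 − 1) is undefined; unbiasedness and the error bound are proved for all ε > 0 with T_1 and T_2 rounded up. *)

(* Defs.v *)
From HB Require Import structures.
From mathcomp Require Import all_boot all_order all_algebra.
From mathcomp Require Import all_classical all_reals.
From mathcomp Require Import ereal topology normedtype sequences measure
  lebesgue_measure lebesgue_integral probability.
Set Implicit Arguments. Unset Strict Implicit. Unset Printing Implicit Defensive.
Import Order.TTheory GRing.Theory Num.Theory.
Local Open Scope classical_set_scope.
Local Open Scope ring_scope.

Section defs.
Context {R : realType}.

Definition dmean (D : probability R R) : R :=
  fine (\int[D]_x (x%:E))%E.
Definition dvar (D : probability R R) : R :=
  fine (\int[D]_x (((x - dmean D) ^+ 2)%:E))%E.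

Definition supported01 (D : probability R R) : Prop :=
  D [set` `[0, 1]%R] = 1%E.

Context {d : measure_display} {T : measurableType d} (P : probability T R).

(* Mutual independence of the sequence X_0, X_1, ...: for every n and all
   Borel sets B_0..B_{n-1}, the joint probability factorizes (taking B_i = setT
   recovers every finite subfamily). *)
Definition mutually_independent (X : nat -> {RV P >-> R}) : Prop :=
  forall (n : nat) (B : nat -> set R), (forall i, measurable (B i)) ->
    P (\big[setI/setT]_(i < n) (X i @^-1` B i)) =
    (\prod_(i < n) P (X i @^-1` B i))%E.

Definition iid_with_law (X : nat -> {RV P >-> R}) (D : probability R R) : Prop :=
  mutually_independent X /\
  forall i (A : set R), measurable A -> P (X i @^-1` A) = D A.

Definition T1 (eps : R) : nat := `|Num.ceil (eps^-1)|%N.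

Definition mu_tilde (X : nat -> {RV P >-> R}) (eps : R) (w : T) : R :=
  (\sum_(i < T1 eps) X i w) / (T1 eps)%:R.

Definition sigma_tilde2 (X : nat -> {RV P >-> R}) (eps : R) (w : T) : R :=
  (\sum_(i < T1 eps) (X i w - mu_tilde X eps w) ^+ 2) / (T1 eps).-1%:R.

Definition T2 (X : nat -> {RV P >-> R}) (eps : R) (w : T) : R :=
  eps^-1 + 5 * sigma_tilde2 X eps w / eps ^+ 2.

Definition N2 (X : nat -> {RV P >-> R}) (eps : R) (w : T) : nat :=
  `|Num.ceil (T2 X eps w)|%N.

Definition mu_hat (X : nat -> {RV P >-> R}) (eps : R) (w : T) : R :=
  (\sum_(i < N2 X eps w) X (T1 eps + i)%N w) / (N2 X eps w)%:R.

End defs.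

(* Main.v *)
Require Import Defs.
From HB Require Import structures.
From mathcomp Require Import all_boot all_order all_algebra.
From mathcomp Require Import all_classical all_reals.
From mathcomp Require Import ereal topology normedtype sequences measure
  lebesgue_measure lebesgue_integral probability measurable_realfun numfun.
From mathcomp Require Import ring lra.
Import Order.TTheory GRing.Theory Num.Theory.
Local Open Scope classical_set_scope.
Local Open Scope ring_scope.

(* Write v for the variance of D, S for the first-stage sample variance and
   n = T1 >= 1/eps.  The second stage is independent of the first, so the bias
   vanishes and the mean squared error is
   E[v / N2] <= eps^2 E[v / (eps + 5 S)].  The pointwise bound
   v / (eps + 5 s) <= 2/5 + (s - v)^2 / (eps v), valid for all s >= 0, reduces
   the claim to E[(S - v)^2] <= 2 eps v, since 2/5 + 2 <= 2.58.

   If n >= 2, the centered variables Y_i = X_i - mu give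
   S - v = (1/n) sum_j (Y_j^2 - v) - 2/(n (n-1)) sum_j Y_j (sum_(i<j) Y_i),
   a martingale whose second moment, at most 2 v / n, is computed by induction.
   If n = 1, then S = 0 (a division by zero) and v^2 <= v <= eps v.

   Independence enters only as E[f h(X_k)] = E[f] E[h(X_k)] for f bounded and
   measurable with respect to X_0, ..., X_(k-1).  Clipping the samples to [0, 1]
   changes them on a null set only and makes every function bounded. *)

(** * Algebra of the sample variance and the pointwise inequality *)

Lemma sqr_sum_ordered (R : comPzRingType) (y : nat -> R) n :
  (\sum_(i < n) y i) ^+ 2 =
  \sum_(i < n) y i ^+ 2 + (\sum_(j < n) y j * \sum_(i < j) y i) *+ 2.
Proof.
elim: n => [|n IH]; first by rewrite !big_ord0 expr0n mul0rn addr0.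
by rewrite !big_ord_recr/= sqrrD IH mulrnDl; ring.
Qed.

(** The left side is invariant under shifting all samples by [c]: with [W] the sum of the shifted
    samples, the squared deviations add up to the sum of squares minus W^2 / n. Expanding W^2 with
    each product attached to its larger index leaves the weight 1/(n-1) - 1/(n (n-1)) = 1/n on the
    squares, and the cross terms take the form of a martingale. *)
Lemma sample_varianceE (R : numFieldType) (x : nat -> R) (c : R) n : (1 < n)%N ->
  (\sum_(i < n) (x i - (\sum_(j < n) x j) / n%:R) ^+ 2) / n.-1%:R =
  (\sum_(i < n) (x i - c) ^+ 2) / n%:R +
  - 2 / (n%:R * n.-1%:R) * \sum_(j < n) (x j - c) * \sum_(i < j) (x i - c).
Proof.
move=> n1.
have n0 : n%:R != 0 :> R by rewrite pnatr_eq0; case: (n) n1.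
have m0 : n.-1%:R != 0 :> R by rewrite pnatr_eq0; case: (n) n1 => [|[|]].
have nE : n%:R = n.-1%:R + 1 :> R by rewrite natr1 prednK// ltnW.
set W := \sum_(i < n) (x i - c).
have -> : \sum_(i < n) (x i - (\sum_(j < n) x j) / n%:R) ^+ 2 =
    \sum_(i < n) (x i - c) ^+ 2 - W ^+ 2 / n%:R.
  have xW : \sum_(j < n) x j = W + n%:R * c.
    by rewrite /W sumrB sumr_const card_ord -[c *+ n]mulr_natl subrK.
  have -> : \sum_(i < n) (x i - (\sum_(j < n) x j) / n%:R) ^+ 2 =
      \sum_(i < n) ((x i - c) ^+ 2 + (- 2 * W / n%:R) * (x i - c) + W ^+ 2 / n%:R ^+ 2).
    by apply: eq_bigr => i _; rewrite xW; field.
  rewrite !big_split/= -mulr_sumr -/W sumr_const card_ord -[_ *+ n]mulr_natl.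
  by field.
have := sqr_sum_ordered _ (fun i => x i - c) n; rewrite -/W => ->.
set Q := \sum_(i < n) _; set M := \sum_(j < n) _.
rewrite -[_ *+ 2]mulr_natl nE; field.
by rewrite -nE n0 m0.
Qed.

(** Put q = (s - v)^2 / (e v) and multiply by e + 5 s. Then q e = v - 2 s + s^2 / v, and the
    constant 2/5 is the one for which 2/5 * 5 s cancels - 2 s; everything left besides v is
    nonnegative. *)
Lemma inverse_sample_size_bound (R : realFieldType) (v e s : R) :
  0 <= v -> 0 < e -> 0 <= s -> v / (e + 5 * s) <= 2 / 5 + (s - v) ^+ 2 / (e * v).
Proof.
move=> v0 e0 s0.
have es : 0 < e + 5 * s by lra.
(* For v = 0 the last quotient is 0, because the inverse of zero is zero. *)
have [->|vn0] := eqVneq v 0; first by rewrite mul0r mulr0 invr0 mulr0; lra.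
have {v0 vn0}v0 : 0 < v by rewrite lt_neqAle eq_sym vn0.
rewrite ler_pdivrMr// mulrDl.
have q0 : 0 <= (s - v) ^+ 2 / (e * v) by rewrite divr_ge0 ?sqr_ge0 ?mulr_ge0 ?ltW.
have qe : (s - v) ^+ 2 / (e * v) * e = v - 2 * s + s ^+ 2 / v.
  by field; rewrite !gt_eqF.
have sv : 0 <= s ^+ 2 / v by rewrite divr_ge0 ?sqr_ge0 ?ltW.
have qs : 0 <= (s - v) ^+ 2 / (e * v) * (5 * s) by apply: mulr_ge0 => //; lra.
by rewrite (mulrDr ((s - v) ^+ 2 / (e * v))) qe; lra.
Qed.

(** * Integral of a product of two independent bounded variables *)

Section independence.
Context {R : realType} {d : measure_display} {T : measurableType d}.
Variable P : probability T R.

Lemma bounded_integrable (f : T -> R) (C : R) :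
  measurable_fun setT f -> (forall w, `|f w| <= C) ->
  P.-integrable setT (EFin \o f).
Proof.
move=> mf fC; apply: measurable_bounded_integrable => //.
  by rewrite [ltLHS](probability_setT P) ltry.
exists C; split; first exact: num_real.
by move=> x Cx y _ /=; apply: (le_trans (fC y)); exact: ltW.
Qed.

(** By uniqueness of the product measure on rectangles, the law of the pair (f, g) is the product of
    the two laws. Integrating the coordinate product against it by Fubini separates the factors. *)
Lemma RintegralM_indep (f g : {RV P >-> R}) (C K : R) :
  (forall w, `|f w| <= C) -> (forall w, `|g w| <= K) ->
  (forall A B, measurable A -> measurable B ->
    P (f @^-1` A `&` g @^-1` B) = (P (f @^-1` A) * P (g @^-1` B))%E) ->
  \int[P]_w (f w * g w) = \int[P]_w f w * \int[P]_w g w.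
Proof.
move=> fC gK fg.
have mf : measurable_fun setT f by exact: measurable_funPT.
have mg : measurable_fun setT g by exact: measurable_funPT.
have intf := bounded_integrable _ _ mf fC.
have intg := bounded_integrable _ _ mg gK.
have mp : measurable_fun setT (fun w => (f w, g w)) by exact: measurable_fun_pair.
have intfg : P.-integrable setT (EFin \o (fun w => f w * g w)).
  apply: (bounded_integrable _ (C * K)); first exact: measurable_funM.
  by move=> w; rewrite normrM ler_pM.
have mM : measurable_fun setT (fun z : R * R => (z.1 * z.2)%:E).
  by apply/measurable_EFinP; apply: measurable_funM.
pose h : {mfun T >-> (R * R)%type} := HB.pack (fun w => (f w, g w))
  (isMeasurableFun.Build _ _ _ _ _ mp).
pose m1 := distribution P f; pose m2 := distribution P g.
have E A : measurable A -> (m1 \x m2)%E A = distribution P h A.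
  by apply: product_measure_unique => B D mB mD; rewrite -fg.
have intM : (m1 \x m2)%E.-integrable setT (fun z : R * R => (z.1 * z.2)%:E).
  apply/integrableP; split => //.
  rewrite (eq_measure_integral (distribution P h)); last by move=> A mA _; exact: E.
  rewrite ge0_integral_distribution//; last exact: measurableT_comp.
  by case/integrableP : intfg.
have : (\int[P]_w (f w * g w)%R%:E = ((\int[P]_w f w)%R * (\int[P]_w g w)%R)%R%:E)%E.
  have -> : (\int[P]_w (f w * g w)%R%:E = \int[distribution P h]_z (z.1 * z.2)%R%:E)%E.
    by rewrite integral_distribution.
  rewrite -(eq_measure_integral (distribution P h) (m1 := (m1 \x m2)%E)); last first.
    by move=> A mA _; exact: E.
  rewrite -integral12_prod_meas1//= /fubini_F/=.
  have Eg : (\int[m2]_y y%:E = (\int[P]_w g w)%:E)%E.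
    rewrite integral_distribution//.
    by rewrite /Rintegral fineK//; exact: integrable_fin_num intg.
  have Im2 : m2.-integrable setT (fun y : R => y%:E).
    by apply: integrable_pushforward => //; exact/measurable_EFinP.
  under eq_integral => x _ do under eq_integral => y _ do rewrite EFinM.
  under eq_integral => x _.
    rewrite integralZl// Eg muleC. over.
  rewrite integralZl//; last first.
    by apply: integrable_pushforward => //; exact/measurable_EFinP.
  rewrite integral_distribution//.
  rewrite muleC EFinM; congr (_ * _)%E.
  by rewrite /Rintegral fineK//; exact: integrable_fin_num intf.
by move=> Efg; rewrite [LHS]/Rintegral Efg.
Qed.

End independence.

(** * The sigma-algebra of the first m samples and its bounded measurable functions *)

Section history.
Context {R : realType} {d : measure_display} {T : measurableType d}.
Variable P : probability T R.
Variable X : nat -> {RV P >-> R}.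

(** A pi-system generating the sigma-algebra of X_0, ..., X_(m-1). Its members are the intersections
    that occur in [mutually_independent], so the factorization applies to them directly. *)
Definition cylinders (m : nat) : set (set T) :=
  [set A | exists2 B : nat -> set R, (forall i, measurable (B i)) &
    A = \big[setI/setT]_(i < m) (X i @^-1` B i)].

Definition history (m : nat) := <<s cylinders m >>.

Lemma cylinders_measurable m : cylinders m `<=` measurable.
Proof.
move=> _ [B mB ->]; apply: bigsetI_measurable => i _.
by rewrite -[X in measurable X]setTI; exact: measurable_funPT.
Qed.

Lemma history_measurable m : history m `<=` measurable.
Proof.
apply: smallest_sub; [exact: sigma_algebra_measurable|exact: cylinders_measurable].
Qed.

Lemma cylindersT m : cylinders m setT.
Proof. by exists (fun=> setT) => //; rewrite big1. Qed.

Lemma cylindersI m : setI_closed (cylinders m).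
Proof.
move=> _ _ [B mB ->] [C mC ->]; exists (fun i => B i `&` C i).
  by move=> i; exact: measurableI.
by rewrite -big_split; apply: eq_bigr => i _; rewrite preimage_setI.
Qed.

Lemma cylinders_coord m k (B : set R) : (k < m)%N -> measurable B ->
  cylinders m (X k @^-1` B).
Proof.
move=> km mB; exists (fun i => if i == k then B else setT).
  by move=> i; case: ifP.
rewrite (bigD1 (Ordinal km))//= eqxx big1 ?setIT// => i.
by rewrite -val_eqE/= => /negbTE ->.
Qed.

Lemma cylindersS m n : (m <= n)%N -> cylinders m `<=` cylinders n.
Proof.
move=> mn _ [B mB ->]; exists (fun i => if (i < m)%N then B i else setT).
  by move=> i; case: ifP.
rewrite (big_ord_widen_cond n xpredT (fun i => X i @^-1` B i))//=.
by rewrite big_mkcond; apply: eq_bigr => i _; case: ifP.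
Qed.

Lemma historyS m n : (m <= n)%N -> history m `<=` history n.
Proof.
by move=> mn; apply: sub_sigma_algebra2; exact: cylindersS.
Qed.

(** As functions of [A], both sides are finite measures: P restricted to the event of X_k, and P
    scaled by the probability of that event. They agree on the pi-system of cylinders, hence on the
    sigma-algebra it generates. *)
Lemma history_indep m k (A : set T) (B : set R) :
  mutually_independent X -> (m <= k)%N -> history m A -> measurable B ->
  P (A `&` X k @^-1` B) = (P A * P (X k @^-1` B))%E.
Proof.
move=> indX mk hA mB.
have mXB : measurable (X k @^-1` B).
  by rewrite -[X in measurable X]setTI; exact: measurable_funPT.
have PXB : P (X k @^-1` B) = (fine (P (X k @^-1` B)))%:E.
  by rewrite fineK// fin_num_measure.
have r0 : 0 <= fine (P (X k @^-1` B)) by rewrite fine_ge0.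
pose m1 := mrestr P mXB.
pose m2 := mscale (NngNum r0) P.
have : m1 A = m2 A.
  apply: (g_sigma_algebra_measure_unique (cylinders m) (@cylinders_measurable m)
    (fun=> setT)) => //.
  - by move=> _; exact: cylindersT.
  - by rewrite bigcup_const.
  - exact: cylindersI.
  - move=> _ [C mC ->].
    (* Independence is stated for initial segments only, so the indices from m to k - 1 are padded
       with [setT], which changes neither the intersection nor the product. *)
    pose C' i := if (i < m)%N then C i else if i == k then B else setT.
    have mC' i : measurable (C' i) by rewrite /C'; do 2 case: ifP => //.
    have := indX k.+1 C' mC'; rewrite !big_ord_recr/=.
    have -> : C' k = B by rewrite /C' ltnNge mk/= eqxx.
    have -> : \big[setI/setT]_(i < k) (X i @^-1` C' i) =
              \big[setI/setT]_(i < m) (X i @^-1` C i).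
      rewrite (big_ord_widen_cond k xpredT (fun i => X i @^-1` C i))//=.
      rewrite [RHS]big_mkcond; apply: eq_bigr => i _; rewrite /C'.
      by case: ifP => // _; rewrite ltn_eqF.
    have -> : (\prod_(i < k) P (X i @^-1` C' i) = \prod_(i < m) P (X i @^-1` C i))%E.
      rewrite (big_ord_widen_cond k xpredT (fun i => P (X i @^-1` C i)))//=.
      rewrite [RHS]big_mkcond; apply: eq_bigr => i _; rewrite /C'.
      by case: ifP => // _; rewrite ltn_eqF// preimage_setT probability_setT.
    rewrite -(indX m C mC) => E.
    by rewrite /m1 /m2 /= /mrestr /mscale/= E muleC -PXB.
  - by move=> _; rewrite /m1 /= /mrestr setTI PXB ltry.
by rewrite /m1 /m2 /= /mrestr /mscale/= => ->; rewrite -PXB muleC.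
Qed.

(** Boundedness is bundled with measurability so that this class is closed under sums and products
    and consists of integrable functions; every integrability condition below reduces to
    membership. *)
Definition bounded_history (m : nat) (f : T -> R) :=
  (exists C, forall w, `|f w| <= C) /\
  (forall B, measurable B -> history m (f @^-1` B)).

(** Taking the history as the measurable sets of a type makes the general closure properties of
    measurable functions available for it. *)
Lemma history_fun m (f : T -> R) :
  measurable_fun setT (f : g_sigma_algebraType (cylinders m) -> R) <->
  (forall B, measurable B -> history m (f @^-1` B)).
Proof.
split=> [mf B mB|mf _ B mB].
  by rewrite -[X in history m X]setTI; exact: mf.
by rewrite setTI; exact: mf.
Qed.

Lemma bounded_history_integrable m f : bounded_history m f ->
  P.-integrable setT (EFin \o f).
Proof.
move=> [[C fC] mf]; apply: (bounded_integrable _ _ C) => // _ B mB.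
by rewrite setTI; apply: history_measurable; exact: mf.
Qed.

Lemma bounded_historyS m n f : (m <= n)%N ->
  bounded_history m f -> bounded_history n f.
Proof. by move=> mn [bf mf]; split=> // B /mf; exact: historyS. Qed.

Lemma bounded_history_cst m c : bounded_history m (fun=> c).
Proof.
split; first by exists `|c|.
by apply/history_fun; exact: measurable_cst.
Qed.

Lemma bounded_historyD m f g : bounded_history m f -> bounded_history m g ->
  bounded_history m (fun w => f w + g w).
Proof.
move=> [[C fC] /history_fun mf] [[K gK] /history_fun mg]; split.
  by exists (C + K) => w; rewrite (le_trans (ler_normD _ _))// lerD.
by apply/history_fun; exact: measurable_funD.
Qed.

Lemma bounded_historyM m f g : bounded_history m f -> bounded_history m g ->
  bounded_history m (fun w => f w * g w).
Proof.
move=> [[C fC] /history_fun mf] [[K gK] /history_fun mg]; split.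
  by exists (C * K) => w; rewrite normrM ler_pM.
by apply/history_fun; exact: measurable_funM.
Qed.

Lemma bounded_history_sum m n (f : nat -> T -> R) :
  (forall i, (i < n)%N -> bounded_history m (f i)) ->
  bounded_history m (fun w => \sum_(i < n) f i w).
Proof.
elim: n => [|n IH] bf.
  rewrite [X in bounded_history _ X](_ : _ = fun=> 0).
    exact: bounded_history_cst.
  by apply/funext => w; rewrite big_ord0.
rewrite [X in bounded_history _ X](_ : _ = fun w => \sum_(i < n) f i w + f n w).
  by apply: bounded_historyD; [apply: IH => i /ltnW|]; apply: bf.
by apply/funext => w; rewrite big_ord_recr.
Qed.

Lemma bounded_history_comp m f (h : R -> R) C : bounded_history m f ->
  measurable_fun setT h -> (forall w, `|h (f w)| <= C) ->
  bounded_history m (h \o f).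
Proof.
move=> [_ mf] mh hC; split; first by exists C.
move=> B mB; rewrite comp_preimage; apply: mf.
by rewrite -[X in measurable X]setTI; exact: mh.
Qed.

(** The bound concerns [h] along the values of the sample only, since the functions used later, such
    as the shift by the mean, are unbounded on the real line. *)
Lemma bounded_history_coord m k (h : R -> R) C : (k < m)%N ->
  measurable_fun setT h -> (forall w, `|h (X k w)| <= C) ->
  bounded_history m (h \o X k).
Proof.
move=> km mh hC; split; first by exists C.
move=> B mB; rewrite comp_preimage; apply: sub_sigma_algebra.
by apply: cylinders_coord => //; rewrite -[X in measurable X]setTI; exact: mh.
Qed.

(** The form in which independence enters all moment computations: [f] depends on samples before
    X_m, and m <= k places X_k strictly after them. *)
Lemma RintegralM_history m k f (h : R -> R) C :
  mutually_independent X -> (m <= k)%N -> bounded_history m f ->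
  measurable_fun setT h -> (forall w, `|h (X k w)| <= C) ->
  \int[P]_w (f w * h (X k w)) = \int[P]_w f w * \int[P]_w h (X k w).
Proof.
move=> indX mk [[K fK] mf] mh hC.
have mf' : measurable_fun setT f.
  by move=> _ B mB; rewrite setTI; apply: history_measurable; exact: mf.
have mg : measurable_fun setT (h \o X k) by exact: measurableT_comp.
pose F : {RV P >-> R} := HB.pack f (isMeasurableFun.Build _ _ _ _ _ mf').
pose G : {RV P >-> R} := HB.pack (h \o X k) (isMeasurableFun.Build _ _ _ _ _ mg).
apply: (@RintegralM_indep _ _ _ P F G K C) => // A B mA mB.
rewrite /= comp_preimage; apply: (@history_indep m k) => //; first exact: mf.
by rewrite -[X in measurable X]setTI; exact: mh.
Qed.

Lemma Rintegral_lin m f g c : bounded_history m f -> bounded_history m g ->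
  \int[P]_w (f w + c * g w) = \int[P]_w f w + c * \int[P]_w g w.
Proof.
move=> bf bg; rewrite RintegralD//; last 2 first.
- exact: bounded_history_integrable bf.
- have bcg := bounded_historyM _ _ _ (bounded_history_cst m c) bg.
  exact: bounded_history_integrable bcg.
by rewrite RintegralZl//; exact: bounded_history_integrable bg.
Qed.

Lemma Rintegral_scale m f c : bounded_history m f ->
  \int[P]_w (c * f w) = c * \int[P]_w f w.
Proof. by move=> bf; rewrite RintegralZl//; exact: bounded_history_integrable bf. Qed.

Lemma Rintegral_cstT c : \int[P]_w (fun=> c) w = c.
Proof. by rewrite Rintegral_cst// [X in fine X](probability_setT P) mulr1. Qed.

Lemma Rintegral_bigsum m n (f : nat -> T -> R) :
  (forall i, (i < n)%N -> bounded_history m (f i)) ->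
  \int[P]_w (\sum_(i < n) f i w) = \sum_(i < n) \int[P]_w f i w.
Proof.
elim: n => [|n IH] bf.
  rewrite big_ord0 -[RHS]Rintegral_cstT; apply: eq_Rintegral => w _.
  by rewrite big_ord0.
rewrite big_ord_recr/= -IH; last by move=> i /ltnW; exact: bf.
rewrite -[X in _ + X]mul1r -(Rintegral_lin m); last exact: bf.
  by apply: eq_Rintegral => w _; rewrite big_ord_recr mul1r.
by apply: bounded_history_sum => i /ltnW; exact: bf.
Qed.

Lemma Rintegral_law k (D : probability R R) (h : R -> R) C :
  (forall A, measurable A -> P (X k @^-1` A) = D A) ->
  measurable_fun setT h -> (forall w, `|h (X k w)| <= C) ->
  (\int[P]_w h (X k w) = \int[D]_x h x).
Proof.
move=> lawX mh hC; rewrite /Rintegral.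
rewrite [in RHS](eq_measure_integral (distribution P (X k))); last first.
  by move=> A mA _; first [exact: lawX|exact/esym/lawX].
rewrite integral_distribution//; first exact/measurable_EFinP.
by apply: (bounded_integrable _ _ C) => //; exact: measurableT_comp.
Qed.

End history.

(** * Moments of centered samples when every sample lies in the unit interval *)

Section unit_interval_samples.
Context {R : realType} {d : measure_display} {T : measurableType d}.
Variable P : probability T R.
Variables (X : nat -> {RV P >-> R}) (D : probability R R).
Hypothesis iidX : iid_with_law X D.
Hypothesis X01 : forall i w, 0 <= X i w <= 1.

Local Notation mu := (dmean D).
Local Notation v := (dvar D).
Local Notation Y i w := (X i w - mu).

Let indX : mutually_independent X := iidX.1.
Let lawX k A : measurable A -> P (X k @^-1` A) = D A.
Proof. by move=> mA; case: iidX => _; exact. Qed.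

Let integrable_const c : P.-integrable setT (EFin \o (fun=> c)).
Proof. by apply: (bounded_integrable _ _ `|c|) => //; exact: measurable_cst. Qed.

Let normX k w : `|X k w| <= 1.
Proof. by have /andP[X0 X1] := X01 k w; rewrite ger0_norm. Qed.

Lemma mean_sample k : \int[P]_w X k w = mu.
Proof.
rewrite (Rintegral_law P X k D idfun 1)//.
- exact: lawX.
- exact: measurable_id.
- exact: normX.
Qed.

Lemma dmean01 : 0 <= mu <= 1.
Proof.
rewrite -(mean_sample 0); apply/andP; split.
  by apply: Rintegral_ge0 => w _; have /andP[] := X01 0 w.
rewrite -[leRHS](Rintegral_cstT P 1); apply: le_Rintegral => //.
  by apply: (bounded_integrable _ _ 1).
by move=> w _; have /andP[] := X01 0 w.
Qed.

Lemma norm_centered k w : `|Y k w| <= 1.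
Proof.
have /andP[m0 m1] := dmean01; have /andP[x0 x1] := X01 k w.
by rewrite ler_norml; apply/andP; split; lra.
Qed.

Lemma measurable_shift : measurable_fun setT (fun x : R => x - mu).
Proof. by apply: measurable_funB => //; exact: measurable_cst. Qed.

Lemma bounded_centered m k : (k < m)%N -> bounded_history P X m (fun w => Y k w).
Proof.
move=> km; apply: (bounded_history_coord P X m k (fun x => x - mu) 1) => //.
  exact: measurable_shift.
by move=> w; exact: norm_centered.
Qed.

Lemma bounded_history_sqr m f : bounded_history P X m f ->
  bounded_history P X m (fun w => f w ^+ 2).
Proof.
move=> bf; rewrite [X in bounded_history _ _ _ X](_ : _ = fun w => f w * f w).
  exact: bounded_historyM.
by apply/funext => w; rewrite expr2.
Qed.

Lemma Rintegral_centered k : \int[P]_w Y k w = 0.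
Proof.
transitivity (\int[P]_w (- mu + 1 * X k w)).
  by apply: eq_Rintegral => w _; ring.
rewrite (Rintegral_lin P X k.+1).
- by rewrite Rintegral_cstT mean_sample; ring.
- exact: bounded_history_cst.
- apply: (bounded_history_coord P X k.+1 k idfun 1) => //.
    exact: measurable_id.
  exact: normX.
Qed.

Lemma Rintegral_centered_sqr k : \int[P]_w (Y k w ^+ 2) = v.
Proof.
rewrite (Rintegral_law P X k D (fun x => (x - mu) ^+ 2) 1)//.
- exact: lawX.
- by apply: measurable_funX; exact: measurable_shift.
- by move=> w; rewrite normrX expr_le1// norm_centered.
Qed.

Lemma centered_sqr_le1 k w : Y k w ^+ 2 <= 1.
Proof. by rewrite -[_ ^+ 2]ger0_norm ?sqr_ge0// normrX expr_le1// norm_centered. Qed.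

Lemma dvar01 : 0 <= v <= 1.
Proof.
rewrite -(Rintegral_centered_sqr 0); apply/andP; split.
  by apply: Rintegral_ge0 => w _; exact: sqr_ge0.
rewrite -[leRHS](Rintegral_cstT P 1); apply: le_Rintegral => //.
  apply: (bounded_history_integrable P X 1).
  by apply: bounded_history_sqr; exact: bounded_centered.
by move=> w _; exact: centered_sqr_le1.
Qed.

Section future.
Variables (m k : nat) (f : T -> R).
Hypotheses (mk : (m <= k)%N) (bf : bounded_history P X m f).

Let bf' : bounded_history P X k.+1 f.
Proof. by apply: bounded_historyS bf; exact: leqW. Qed.

(** The martingale difference property of Y_k, tested against bounded functions of the past. *)
Lemma Rintegral_mul_centered : \int[P]_w (f w * Y k w) = 0.
Proof.
rewrite (RintegralM_history P X m k f (fun x => x - mu) 1)//.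
- by rewrite Rintegral_centered mulr0.
- exact: measurable_shift.
- by move=> w; exact: norm_centered.
Qed.

Lemma Rintegral_mul_centered_sqr :
  \int[P]_w (f w * Y k w ^+ 2) = (\int[P]_w f w) * v.
Proof.
rewrite (RintegralM_history P X m k f (fun x => (x - mu) ^+ 2) 1)//.
- by rewrite Rintegral_centered_sqr.
- by apply: measurable_funX; exact: measurable_shift.
- by move=> w; rewrite normrX expr_le1// norm_centered.
Qed.

Lemma Rintegral_mul_centered_sqrB :
  \int[P]_w (f w * (Y k w ^+ 2 - v)) = 0.
Proof.
transitivity (\int[P]_w (f w * Y k w ^+ 2 + (- v) * f w)).
  by apply: eq_Rintegral => w _; ring.
rewrite (Rintegral_lin P X k.+1)//.
  by rewrite Rintegral_mul_centered_sqr; ring.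
apply: bounded_historyM => //; apply: bounded_history_sqr.
exact: bounded_centered.
Qed.

End future.

(** Since |Y| <= 1, the fourth moment is at most the second, which is v; expanding the square
    subtracts 2 v^2 and adds v^2. *)
Lemma Rintegral_centered_sqrB_sqr k :
  \int[P]_w ((Y k w ^+ 2 - v) ^+ 2) <= v - v ^+ 2.
Proof.
have bY := bounded_centered k.+1 k (ltnSn k).
have bY2 := bounded_history_sqr _ _ bY.
have bY4 := bounded_history_sqr _ _ bY2.
have -> : \int[P]_w ((Y k w ^+ 2 - v) ^+ 2) =
  \int[P]_w (((Y k w ^+ 2) ^+ 2 + (- 2 * v) * (Y k w ^+ 2)) + v ^+ 2 * 1).
  by apply: eq_Rintegral => w _; ring.
rewrite (Rintegral_lin P X k.+1); last 2 first.
- apply: bounded_historyD => //; apply: bounded_historyM => //.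
  exact: bounded_history_cst.
- exact: bounded_history_cst.
rewrite (Rintegral_lin P X k.+1)// Rintegral_centered_sqr Rintegral_cstT.
have : \int[P]_w ((Y k w ^+ 2) ^+ 2) <= v.
  rewrite -(Rintegral_centered_sqr k); apply: le_Rintegral => //.
  - exact: bounded_history_integrable bY4.
  - exact: bounded_history_integrable bY2.
  - by move=> w _; rewrite [leLHS]expr2 ler_piMl ?sqr_ge0// centered_sqr_le1.
by move=> ?; lra.
Qed.

(** * Sums of consecutive centered samples *)

(** It serves twice: from n = [T1 eps] it is the centered sum of the second stage, and from n = 0 it
    is the sum of the samples preceding X_k in the first stage. *)
Definition future_sum (n k : nat) (w : T) := \sum_(i < k) Y (n + i) w.

Lemma bounded_future_sum n k : bounded_history P X (n + k) (future_sum n k).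
Proof.
apply: (bounded_history_sum P X (n + k) k (fun i w => Y (n + i) w)) => i ik.
by apply: bounded_centered; rewrite ltn_add2l.
Qed.

Lemma Rintegral_mul_future_sum n k f : bounded_history P X n f ->
  \int[P]_w (f w * future_sum n k w) = 0.
Proof.
move=> bf; elim: k => [|k IH].
  rewrite -[RHS](Rintegral_cstT P); apply: eq_Rintegral => w _.
  by rewrite /future_sum big_ord0 mulr0.
transitivity (\int[P]_w (f w * future_sum n k w + 1 * (f w * Y (n + k) w))).
  by apply: eq_Rintegral => w _; rewrite /future_sum big_ord_recr/=; ring.
rewrite (Rintegral_lin P X (n + k.+1)).
- by rewrite IH (Rintegral_mul_centered n) ?leq_addr// mulr0 addr0.
- apply: bounded_historyM.
    by apply: bounded_historyS bf; exact: leq_addr.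
  by apply: bounded_historyS (bounded_future_sum n k); rewrite leq_add2l.
- apply: bounded_historyM.
    by apply: bounded_historyS bf; exact: leq_addr.
  by apply: bounded_centered; rewrite ltn_add2l.
Qed.

(** The weight [f] will be an indicator of the second-stage size. Each new sample adds a cross term,
    which vanishes because Y_(n+k) is centered given its past, and a square, which contributes v
    times the integral of [f]. *)
Lemma Rintegral_mul_future_sum_sqr n k f : bounded_history P X n f ->
  \int[P]_w (f w * future_sum n k w ^+ 2) = k%:R * v * \int[P]_w f w.
Proof.
move=> bf; elim: k => [|k IH].
  rewrite !mul0r -[RHS](Rintegral_cstT P); apply: eq_Rintegral => w _.
  by rewrite /future_sum big_ord0 expr0n mulr0.
have bf' : bounded_history P X (n + k) f.
  by apply: bounded_historyS bf; exact: leq_addr.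
have bfS := bounded_historyM _ _ _ _ _ bf' (bounded_future_sum n k).
have up g : bounded_history P X (n + k) g -> bounded_history P X (n + k.+1) g.
  by apply: bounded_historyS; rewrite leq_add2l.
have bY : bounded_history P X (n + k.+1) (fun w => Y (n + k) w).
  by apply: bounded_centered; rewrite ltn_add2l.
transitivity (\int[P]_w ((f w * future_sum n k w ^+ 2 +
    2 * ((f w * future_sum n k w) * Y (n + k) w)) + 1 * (f w * Y (n + k) w ^+ 2))).
  by apply: eq_Rintegral => w _; rewrite /future_sum big_ord_recr/=; ring.
have b1 : bounded_history P X (n + k.+1) (fun w => f w * future_sum n k w ^+ 2).
  apply: up; apply: bounded_historyM => //.
  by apply: bounded_history_sqr; exact: bounded_future_sum.
have b2 : bounded_history P X (n + k.+1)
    (fun w => (f w * future_sum n k w) * Y (n + k) w).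
  by apply: bounded_historyM => //; exact: up.
have b3 : bounded_history P X (n + k.+1) (fun w => f w * Y (n + k) w ^+ 2).
  by apply: bounded_historyM; [exact: up|exact: bounded_history_sqr].
rewrite (Rintegral_lin P X (n + k.+1))//; last first.
  by apply: bounded_historyD => //; apply: bounded_historyM => //; exact: bounded_history_cst.
rewrite (Rintegral_lin P X (n + k.+1))// IH.
rewrite (Rintegral_mul_centered (n + k))// (Rintegral_mul_centered_sqr (n + k))//.
by rewrite -natr1; ring.
Qed.

(** * The error of the first-stage sample variance as a martingale *)

(** For m = n, a = 1/n and b = -2/(n (n-1)) this is the sample variance minus v. The coefficients
    are separate parameters because the inductions on m must keep them fixed. *)
Definition stage1_error (a b : R) (m : nat) (w : T) : R :=
  \sum_(j < m) (a * (Y j w ^+ 2 - v) + b * (Y j w * future_sum 0 j w)).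

Lemma Rintegral_future_sum m : \int[P]_w future_sum 0 m w = 0.
Proof.
rewrite -[RHS](Rintegral_mul_future_sum 0 m (fun=> 1)); last exact: bounded_history_cst.
by apply: eq_Rintegral => w _; rewrite mul1r.
Qed.

Lemma Rintegral_future_sum_sqr m : \int[P]_w (future_sum 0 m w ^+ 2) = m%:R * v.
Proof.
have := Rintegral_mul_future_sum_sqr 0 m (fun=> 1) (bounded_history_cst P X 0 1).
rewrite Rintegral_cstT mulr1 => <-.
by apply: eq_Rintegral => w _; rewrite mul1r.
Qed.

Lemma bounded_centered_sqrB m k : (k < m)%N ->
  bounded_history P X m (fun w => Y k w ^+ 2 - v).
Proof.
move=> km; apply: bounded_historyD; last exact: bounded_history_cst.
by apply: bounded_history_sqr; exact: bounded_centered.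
Qed.

Lemma bounded_past_sum m k : (k <= m)%N -> bounded_history P X m (future_sum 0 k).
Proof. by move=> km; apply: bounded_historyS (bounded_future_sum 0 k). Qed.

Lemma bounded_stage1_error a b m : bounded_history P X m (stage1_error a b m).
Proof.
apply: (bounded_history_sum P X m m
  (fun j w => a * (Y j w ^+ 2 - v) + b * (Y j w * future_sum 0 j w))) => j jm.
apply: bounded_historyD; apply: bounded_historyM.
- exact: bounded_history_cst.
- exact: bounded_centered_sqrB.
- exact: bounded_history_cst.
- apply: bounded_historyM; first exact: bounded_centered.
  by apply: bounded_past_sum; exact: ltnW.
Qed.

Lemma Rintegral_stage1_error a b m : \int[P]_w stage1_error a b m w = 0.
Proof.
elim: m => [|m IH].
  rewrite -[RHS](Rintegral_cstT P); apply: eq_Rintegral => w _.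
  by rewrite /stage1_error big_ord0.
transitivity (\int[P]_w ((stage1_error a b m w + a * (1 * (Y m w ^+ 2 - v))) +
    b * (future_sum 0 m w * Y m w))).
  by apply: eq_Rintegral => w _; rewrite /stage1_error big_ord_recr/=; ring.
have c1 := bounded_history_cst P X m.+1.
have bV : bounded_history P X m.+1 (stage1_error a b m).
  by apply: bounded_historyS (bounded_stage1_error a b m).
have bU : bounded_history P X m.+1 (fun w => 1 * (Y m w ^+ 2 - v)).
  by apply: bounded_historyM => //; exact: bounded_centered_sqrB.
rewrite (Rintegral_lin P X m.+1); last 2 first.
- by apply: bounded_historyD => //; exact: bounded_historyM.
- by apply: bounded_historyM; [exact: bounded_past_sum|exact: bounded_centered].
rewrite (Rintegral_lin P X m.+1)// IH.
rewrite (Rintegral_mul_centered_sqrB m m (fun=> 1))//; last exact: bounded_history_cst.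
rewrite (Rintegral_mul_centered m)//; last exact: bounded_past_sum.
by ring.
Qed.

(** The third-moment factor of sample m need not have mean zero; the product vanishes because the
    past sum does and is independent of that factor. *)
Lemma Rintegral_past_sum_cross m :
  \int[P]_w (future_sum 0 m w * ((Y m w ^+ 2 - v) * Y m w)) = 0.
Proof.
have /andP[v0 v1] := dvar01.
rewrite (RintegralM_history P X m m _ (fun x => ((x - mu) ^+ 2 - v) * (x - mu)) 1)//.
- by rewrite Rintegral_future_sum mul0r.
- exact: bounded_past_sum.
- apply: measurable_funM; last exact: measurable_shift.
  apply: measurable_funB; last exact: measurable_cst.
  by apply: measurable_funX; exact: measurable_shift.
- move=> w; rewrite normrM mulr_ile1//; last exact: norm_centered.
  have := centered_sqr_le1 m w; have := sqr_ge0 (Y m w).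
  by rewrite ler_norml => ? ?; apply/andP; split; lra.
Qed.

(** The increment is a U + b W Z, with U = Y_m^2 - v, Z = Y_m and W the past sum. Its products with
    the previous error V vanish by the martingale property, and the term in W U Z by the previous
    lemma. What remains is a^2 E[U^2] and b^2 m v^2, and the factors m accumulate to m (m - 1) /
    2. *)
Lemma Rintegral_stage1_error_sqr a b m :
  \int[P]_w (stage1_error a b m w ^+ 2) <=
  m%:R * a ^+ 2 * (v - v ^+ 2) + b ^+ 2 * v ^+ 2 * (m%:R * (m%:R - 1) / 2).
Proof.
elim: m => [|m IH].
  rewrite !mul0r mulr0 addr0 -[leRHS](Rintegral_cstT P).
  by rewrite le_eqVlt; apply/orP; left; apply/eqP; apply: eq_Rintegral => w _;
     rewrite /stage1_error big_ord0 expr0n.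
pose V := stage1_error a b m; pose U w := Y m w ^+ 2 - v.
pose W := future_sum 0 m; pose Z w := Y m w.
have -> : \int[P]_w (stage1_error a b m.+1 w ^+ 2) =
  \int[P]_w (((((V w ^+ 2 + (2 * a) * (V w * U w)) + (2 * b) * ((V w * W w) * Z w)) +
    a ^+ 2 * U w ^+ 2) + (2 * a * b) * (W w * (U w * Z w))) +
    b ^+ 2 * (W w ^+ 2 * Z w ^+ 2)).
  apply: eq_Rintegral => w _; rewrite /stage1_error big_ord_recr/= -/(stage1_error a b m w).
  by rewrite /V /U /W /Z; ring.
have bM := bounded_historyM P X m.+1.
have bD := bounded_historyD P X m.+1.
have b2 := bounded_history_sqr m.+1.
have bC := bounded_history_cst P X m.+1.
have bV : bounded_history P X m.+1 V.
  by apply: bounded_historyS (bounded_stage1_error a b m).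
have bU : bounded_history P X m.+1 U by exact: bounded_centered_sqrB.
have bW : bounded_history P X m.+1 W by exact: bounded_past_sum.
have bZ : bounded_history P X m.+1 Z by exact: bounded_centered.
have t1 : bounded_history P X m.+1 (fun w => V w ^+ 2) by exact: b2.
have t2 : bounded_history P X m.+1 (fun w => V w * U w) by exact: bM.
have t3 : bounded_history P X m.+1 (fun w => V w * W w * Z w).
  by apply: (bM) => //; exact: bM.
have t4 : bounded_history P X m.+1 (fun w => U w ^+ 2) by exact: b2.
have t5 : bounded_history P X m.+1 (fun w => W w * (U w * Z w)).
  by apply: (bM) => //; exact: bM.
have t6 : bounded_history P X m.+1 (fun w => W w ^+ 2 * Z w ^+ 2).
  by apply: (bM); exact: b2.
have s2 := bD _ _ t1 (bM _ _ (bC (2 * a)) t2).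
have s3 := bD _ _ s2 (bM _ _ (bC (2 * b)) t3).
have s4 := bD _ _ s3 (bM _ _ (bC (a ^+ 2)) t4).
have s5 := bD _ _ s4 (bM _ _ (bC (2 * a * b)) t5).
rewrite (Rintegral_lin P X m.+1)// (Rintegral_lin P X m.+1)//.
rewrite (Rintegral_lin P X m.+1)// (Rintegral_lin P X m.+1)//.
rewrite (Rintegral_lin P X m.+1)//.
rewrite (Rintegral_mul_centered_sqrB m m V)//; last exact: bounded_stage1_error.
rewrite (Rintegral_mul_centered m m (fun w => V w * W w))//; last first.
  by apply: bounded_historyM; [exact: bounded_stage1_error|exact: bounded_past_sum].
rewrite Rintegral_past_sum_cross.
rewrite (Rintegral_mul_centered_sqr m m (fun w => W w ^+ 2))//; last first.
  by apply: bounded_history_sqr; exact: bounded_past_sum.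
rewrite Rintegral_future_sum_sqr.
have H : a ^+ 2 * \int[P]_w (U w ^+ 2) <= a ^+ 2 * (v - v ^+ 2).
  by rewrite ler_wpM2l ?sqr_ge0//; exact: Rintegral_centered_sqrB_sqr.
rewrite -natr1; move: IH H; rewrite -/V.
set p := \int[P]_w _; set q := a ^+ 2 * _ => IH H.
rewrite !mulr0 !addr0.
apply: le_trans (lerD (lerD IH H) (lexx _)) _.
by rewrite le_eqVlt; apply/orP; left; apply/eqP; field.
Qed.

(** * The two sample sizes and the first two moments of the sample variance *)

Section sample_size.
Variable eps : R.
Hypothesis eps_gt0 : 0 < eps.

Local Notation n := (T1 eps).
Local Notation S := (sigma_tilde2 X eps).
Local Notation N := (N2 X eps).

Lemma T1_ge : eps^-1 <= n%:R.
Proof.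
rewrite /T1 natr_absz ger0_norm; first exact: ceil_ge.
by rewrite ceil_ge0 (lt_trans _ (_ : 0 < eps^-1)) ?invr_gt0// ltrN10.
Qed.

Lemma T1_gt0 : (0 < n)%N.
Proof. by rewrite -(ltr_nat R) (lt_le_trans _ T1_ge)// invr_gt0. Qed.

Lemma invT1_le : n%:R^-1 <= eps.
Proof. by rewrite -[leRHS]invrK lef_pV2 ?T1_ge// posrE ?invr_gt0// ltr0n T1_gt0. Qed.

Lemma T1_gt1 : eps < 1 -> (1 < n)%N.
Proof. by move=> e1; rewrite -(ltr_nat R) (lt_le_trans _ T1_ge)// invf_gt1. Qed.

Lemma T1_eq1 : 1 <= eps -> n = 1%N.
Proof.
move=> e1; rewrite /T1; suff -> : Num.ceil eps^-1 = 1 by [].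
by apply: ceil_def; rewrite subrr invr_gt0 eps_gt0 invf_le1.
Qed.

Lemma sigma_tilde2_ge0 w : 0 <= S w.
Proof. by rewrite divr_ge0// sumr_ge0// => i _; exact: sqr_ge0. Qed.

Lemma sigma_tilde2E w : (1 < n)%N ->
  S w = v + stage1_error n%:R^-1 (- 2 / (n%:R * n.-1%:R)) n w.
Proof.
move=> n1; rewrite /sigma_tilde2 /mu_tilde.
rewrite (@sample_varianceE _ (fun i => X i w) mu n n1).
rewrite /stage1_error big_split/= -!mulr_sumr sumrB sumr_const card_ord.
have n0 : n%:R != 0 :> R by rewrite pnatr_eq0 -lt0n T1_gt0.
rewrite -[v *+ n]mulr_natl addrA; congr (_ + _).
by field.
Qed.

Lemma sigma_tilde2_small w : n = 1%N -> S w = 0.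
Proof. by move=> n1; rewrite /sigma_tilde2 n1/= invr0 mulr0. Qed.

Lemma bounded_sigma_tilde2 : bounded_history P X n S.
Proof.
have [e1|e1] := ltP eps 1.
  rewrite [Z in bounded_history _ _ _ Z](_ : _ = fun w =>
    v + stage1_error n%:R^-1 (- 2 / (n%:R * n.-1%:R)) n w).
    by apply: bounded_historyD; [exact: bounded_history_cst|exact: bounded_stage1_error].
  by apply/funext => w; apply: sigma_tilde2E; exact: T1_gt1.
rewrite [Z in bounded_history _ _ _ Z](_ : _ = fun=> 0).
  exact: bounded_history_cst.
by apply/funext => w; apply: sigma_tilde2_small; exact: T1_eq1.
Qed.

(** Unbiasedness requires at least two first-stage samples. For [1 <= eps] there is only one and the
    sample variance is constantly 0, whence the same restriction on the expected sample count. *)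
Lemma Rintegral_sigma_tilde2 : eps < 1 -> \int[P]_w S w = v.
Proof.
move=> e1; transitivity (\int[P]_w (v +
    1 * stage1_error n%:R^-1 (- 2 / (n%:R * n.-1%:R)) n w)).
  by apply: eq_Rintegral => w _; rewrite mul1r sigma_tilde2E// T1_gt1.
rewrite (Rintegral_lin P X n).
- by rewrite Rintegral_cstT Rintegral_stage1_error mulr0 addr0.
- exact: bounded_history_cst.
- exact: bounded_stage1_error.
Qed.

Lemma Rintegral_sigma_tilde2_sqr : \int[P]_w ((S w - v) ^+ 2) <= 2 * eps * v.
Proof.
have /andP[v0 v1] := dvar01.
have vv : v ^+ 2 <= v by rewrite expr2 ler_piMl.
have [e1|e1] := ltP eps 1; last first.
  rewrite (_ : \int[P]_w _ = v ^+ 2).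
    apply: (le_trans vv); rewrite ler_peMl//; lra.
  rewrite -[RHS](Rintegral_cstT P); apply: eq_Rintegral => w _.
  by rewrite sigma_tilde2_small ?T1_eq1// sub0r sqrrN.
have n1 := T1_gt1 e1.
pose b : R := - 2 / (n%:R * n.-1%:R).
rewrite (_ : \int[P]_w _ = \int[P]_w (stage1_error n%:R^-1 b n w ^+ 2)); last first.
  by apply: eq_Rintegral => w _; rewrite sigma_tilde2E// addrAC subrr add0r.
apply: (le_trans (Rintegral_stage1_error_sqr _ _ _)).
have n0 : 0 < n%:R :> R by rewrite ltr0n T1_gt0.
have m1 : 1 <= n.-1%:R :> R by rewrite ler1n -ltnS prednK// T1_gt0.
have nE : n%:R = n.-1%:R + 1 :> R by rewrite natr1 prednK// T1_gt0.
have m0 : 0 < n.-1%:R :> R by lra.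
(* With these coefficients the bound equals (v - v^2 + 2 v^2 / (n-1)) / n. It is at most 2 v / n
   because n - 1 >= 1 and v^2 <= v, and then 1/n <= eps. *)
apply: (@le_trans _ _ (n%:R^-1 * (2 * v))); last first.
  rewrite (_ : 2 * eps * v = eps * (2 * v)); last by ring.
  by rewrite ler_wpM2r ?invT1_le//; lra.
have -> : n%:R * n%:R^-1 ^+ 2 * (v - v ^+ 2) +
    b ^+ 2 * v ^+ 2 * (n%:R * (n%:R - 1) / 2) =
    n%:R^-1 * (v - v ^+ 2 + 2 * v ^+ 2 * n.-1%:R^-1).
  have -> : n%:R - 1 = n.-1%:R :> R by rewrite nE addrK.
  by rewrite /b; field; rewrite !gt_eqF.
rewrite ler_pM2l ?invr_gt0//.
have mi : n.-1%:R^-1 <= 1 :> R by rewrite invf_le1.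
have : 2 * v ^+ 2 * n.-1%:R^-1 <= 2 * v ^+ 2 * 1.
  by rewrite ler_wpM2l// mulr_ge0// sqr_ge0.
lra.
Qed.

Lemma T2_ge w : eps^-1 <= T2 X eps w.
Proof.
rewrite /T2 lerDl divr_ge0 ?sqr_ge0//.
by rewrite mulr_ge0// sigma_tilde2_ge0.
Qed.

Lemma T2_gt0 w : 0 < T2 X eps w.
Proof. by apply: lt_le_trans (T2_ge w); rewrite invr_gt0. Qed.

Lemma N2E w : (N w)%:R = (Num.ceil (T2 X eps w))%:~R :> R.
Proof.
by rewrite /N2 natr_absz ger0_norm// ceil_ge0 (lt_trans _ (T2_gt0 w))// ltrN10.
Qed.

Lemma N2_ge w : T2 X eps w <= (N w)%:R.
Proof. by rewrite N2E ceil_ge. Qed.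

Lemma N2_gt0 w : (0 < N w)%N.
Proof. by rewrite -(ltr_nat R) (lt_le_trans (T2_gt0 w))// N2_ge. Qed.

(** The ceiling of t is k exactly when k - 1 < t <= k. Writing the event that [N2] equals k as an
    interval condition on [T2] makes it a first-stage event. *)
Definition size_indicator (k : nat) (t : R) : R := \1_[set` `]k%:R - 1, k%:R]] t.

Lemma size_indicatorE k w : size_indicator k (T2 X eps w) = (N w == k)%:R.
Proof.
rewrite /size_indicator indicE; congr (_ %:R); congr nat_of_bool.
apply/idP/eqP => [|<-].
  rewrite inE/= in_itv/= => kT; apply/eqP.
  rewrite -(eqr_nat R) N2E (@ceil_def _ _ k)//.
  by rewrite intrB.
rewrite inE/= in_itv/= N2E; have := ceil_itv (T2 X eps w).
by rewrite intrB.
Qed.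

Lemma bounded_T2 : bounded_history P X n (T2 X eps).
Proof.
rewrite [Z in bounded_history _ _ _ Z](_ : _ = fun w => eps^-1 + (5 / eps ^+ 2) * S w).
  apply: bounded_historyD; first exact: bounded_history_cst.
  apply: bounded_historyM; first exact: bounded_history_cst.
  exact: bounded_sigma_tilde2.
by apply/funext => w; rewrite /T2 mulrAC.
Qed.

Lemma bounded_size_indicator k :
  bounded_history P X n (fun w => size_indicator k (T2 X eps w)).
Proof.
apply: (bounded_history_comp P X n _ (size_indicator k) 1).
- exact: bounded_T2.
- by apply: measurable_indic; exact: measurable_itv.
- by move=> w; rewrite size_indicatorE; case: eqP; rewrite ?normr1 ?normr0.
Qed.

(** With samples in the unit interval [T2] is bounded, so splitting according to the value of [N2]
    gives finite sums and requires no limit exchange. *)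
Lemma N2_bounded : exists K, forall w, (N w < K)%N.
Proof.
have [[C TC] _] := bounded_T2.
exists `|Num.ceil C|.+1 => w; rewrite ltnS /N2.
have TCw : T2 X eps w <= C by rewrite (le_trans _ (TC w))// ler_norm.
have c0 : 0 <= Num.ceil (T2 X eps w).
  by rewrite ceil_ge0 (lt_trans _ (T2_gt0 w))// ltrN10.
have cc : Num.ceil (T2 X eps w) <= Num.ceil C by exact: Num.Theory.le_ceil.
by rewrite -lez_nat !gez0_abs// (le_trans c0).
Qed.

Lemma sum_size_indicator K (g : nat -> R) w : (N w < K)%N ->
  \sum_(k < K) size_indicator k (T2 X eps w) * g k = g (N w).
Proof.
move=> NK; rewrite (bigD1 (Ordinal NK))//= size_indicatorE eqxx mul1r.
rewrite big1 ?addr0// => k; rewrite -val_eqE/= eq_sym => /negbTE Nk.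
by rewrite size_indicatorE Nk mul0r.
Qed.

Lemma mu_hatB w : mu_hat X eps w - mu = (N w)%:R^-1 * future_sum n (N w) w.
Proof.
rewrite /mu_hat /future_sum sumrB sumr_const card_ord -[mu *+ _]mulr_natl.
by field; rewrite pnatr_eq0 -lt0n N2_gt0.
Qed.

(** * Bias and mean squared error, by splitting on the second-stage size *)

Section moments.
Variable K : nat.
Hypothesis NK : forall w, (N w < K)%N.

Let J k w := size_indicator k (T2 X eps w).

Let bounded_summand k (c : R) (f : T -> R) : (k < K)%N ->
  bounded_history P X (n + k) f -> bounded_history P X (n + K) (fun w => J k w * c * f w).
Proof.
move=> kK bf; apply: bounded_historyM.
  apply: (bounded_historyS _ _ n); first exact: leq_addr.
  by apply: bounded_historyM; [exact: bounded_size_indicator|exact: bounded_history_cst].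
by apply: bounded_historyS bf; rewrite leq_add2l ltnW.
Qed.

Lemma mu_hatB_sum w : mu_hat X eps w - mu =
  \sum_(k < K) J k w * k%:R^-1 * future_sum n k w.
Proof.
rewrite mu_hatB -(sum_size_indicator K (fun k => k%:R^-1 * future_sum n k w))//.
by apply: eq_bigr => k _; rewrite mulrA.
Qed.

Lemma mu_hatB_sqr_sum w : (mu_hat X eps w - mu) ^+ 2 =
  \sum_(k < K) J k w * k%:R^-1 ^+ 2 * future_sum n k w ^+ 2.
Proof.
rewrite mu_hatB exprMn.
rewrite -(sum_size_indicator K (fun k => k%:R^-1 ^+ 2 * future_sum n k w ^+ 2))//.
by apply: eq_bigr => k _; rewrite mulrA.
Qed.

Lemma bounded_mu_hatB : bounded_history P X (n + K) (fun w => mu_hat X eps w - mu).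
Proof.
rewrite [Z in bounded_history _ _ _ Z](_ : _ = fun w =>
  \sum_(k < K) J k w * k%:R^-1 * future_sum n k w); last exact/funext/mu_hatB_sum.
apply: (bounded_history_sum P X _ K (fun k w => J k w * k%:R^-1 * future_sum n k w)) => k kK.
by apply: bounded_summand => //; exact: bounded_future_sum.
Qed.

(** For each k the weight, indicator over k, depends on the first stage only, while the sum of the k
    fresh centered samples has mean zero given that stage. *)
Lemma Rintegral_mu_hatB : \int[P]_w (mu_hat X eps w - mu) = 0.
Proof.
transitivity (\int[P]_w (\sum_(k < K) J k w * k%:R^-1 * future_sum n k w)).
  by apply: eq_Rintegral => w _; exact: mu_hatB_sum.
rewrite (Rintegral_bigsum P X (n + K) K (fun k w => J k w * k%:R^-1 * future_sum n k w)).
  rewrite big1// => k _; apply: (Rintegral_mul_future_sum n k (fun w => J k w * k%:R^-1)).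
  by apply: bounded_historyM; [exact: bounded_size_indicator|exact: bounded_history_cst].
by move=> k kK; apply: bounded_summand => //; exact: bounded_future_sum.
Qed.

Lemma Rintegral_mu_hatB_sqr :
  \int[P]_w ((mu_hat X eps w - mu) ^+ 2) <= 258 / 100 * eps ^+ 2.
Proof.
have bJ k c : bounded_history P X n (fun w => J k w * c).
  by apply: bounded_historyM; [exact: bounded_size_indicator|exact: bounded_history_cst].
(* On the event that [N2] equals k, the squared sum of k fresh samples contributes k v, and division
   by k^2 leaves v / k. *)
have -> : \int[P]_w ((mu_hat X eps w - mu) ^+ 2) = \int[P]_w (v / (N w)%:R).
  transitivity (\int[P]_w (\sum_(k < K) J k w * k%:R^-1 ^+ 2 * future_sum n k w ^+ 2)).
    by apply: eq_Rintegral => w _; exact: mu_hatB_sqr_sum.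
  transitivity (\int[P]_w (\sum_(k < K) J k w * (v / k%:R))); last first.
    apply: eq_Rintegral => w _.
    exact: (sum_size_indicator K (fun k => v / k%:R) w).
  rewrite (Rintegral_bigsum P X (n + K) K
    (fun k w => J k w * k%:R^-1 ^+ 2 * future_sum n k w ^+ 2)); last first.
    move=> k kK; apply: bounded_summand => //.
    by apply: bounded_history_sqr; exact: bounded_future_sum.
  rewrite (Rintegral_bigsum P X n K (fun k w => J k w * (v / k%:R)))//.
  apply: eq_bigr => k _.
  rewrite (Rintegral_mul_future_sum_sqr n k (fun w => J k w * k%:R^-1 ^+ 2))//.
  rewrite -(Rintegral_scale P X n)//; apply: eq_Rintegral => w _.
  (* The summand for k = 0 vanishes on both sides, the inverse of zero being zero. *)
  have [->|k0] := eqVneq (k : nat) 0%N; first by rewrite invr0 !(mulr0,mul0r).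
  by field; rewrite pnatr_eq0.
have /andP[v0 v1] := dvar01.
have bE : bounded_history P X n (fun w => eps ^+ 2 * (2 / 5) +
    (eps ^+ 2 / (eps * v)) * (S w - v) ^+ 2).
  apply: bounded_historyD; first exact: bounded_history_cst.
  apply: bounded_historyM; first exact: bounded_history_cst.
  apply: bounded_history_sqr; apply: bounded_historyD; last exact: bounded_history_cst.
  exact: bounded_sigma_tilde2.
have bN : bounded_history P X n (fun w => v / (N w)%:R).
  rewrite [Z in bounded_history _ _ _ Z](_ : _ = fun w => \sum_(k < K) J k w * (v / k%:R)).
    by apply: (bounded_history_sum P X n K (fun k w => J k w * (v / k%:R))).
  by apply/funext => w; rewrite (sum_size_indicator K (fun k => v / k%:R)).
(* Pointwise, [N2] >= [T2] and v / [T2] = eps^2 v / (eps + 5 S), to which the inequality for inverse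
   sample sizes applies with e = eps. *)
apply: (@le_trans _ _ (\int[P]_w (eps ^+ 2 * (2 / 5) +
    (eps ^+ 2 / (eps * v)) * (S w - v) ^+ 2))).
  apply: le_Rintegral => //.
  - exact: bounded_history_integrable bN.
  - exact: bounded_history_integrable bE.
  move=> w _; have S0 := sigma_tilde2_ge0 w.
  apply: (@le_trans _ _ (v / T2 X eps w)).
    by rewrite ler_wpM2l// lef_pV2 ?N2_ge// posrE ?T2_gt0// ltr0n N2_gt0.
  have -> : v / T2 X eps w = eps ^+ 2 * (v / (eps + 5 * S w)).
    have ? : 0 < eps + 5 * S w by rewrite ltr_wpDr// mulr_ge0.
    by rewrite /T2; field; rewrite !lt0r_neq0.
  have := inverse_sample_size_bound _ v eps (S w) v0 eps_gt0 S0.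
  move=> /(ler_wpM2l (sqr_ge0 eps)) => H; apply: (le_trans H).
  by rewrite mulrDr (mulrAC (eps ^+ 2) _ ((S w - v) ^+ 2)) -(mulrA (eps ^+ 2)).
rewrite (Rintegral_lin P X n); last 2 first.
- exact: bounded_history_cst.
- apply: bounded_history_sqr; apply: bounded_historyD; last exact: bounded_history_cst.
  exact: bounded_sigma_tilde2.
rewrite Rintegral_cstT.
have [vz|vn0] := eqVneq v 0.
  by rewrite vz mulr0 invr0 mulr0 mul0r addr0; have := sqr_ge0 eps; lra.
have vp : 0 < v by rewrite lt_neqAle eq_sym vn0.
apply: (@le_trans _ _ (eps ^+ 2 * (2 / 5) + eps ^+ 2 / (eps * v) * (2 * eps * v))).
  rewrite lerD2l ler_wpM2l ?Rintegral_sigma_tilde2_sqr//.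
  by rewrite divr_ge0 ?sqr_ge0// mulr_ge0// ltW.
have -> : eps ^+ 2 / (eps * v) * (2 * eps * v) = 2 * eps ^+ 2.
  by field; rewrite !gt_eqF.
by have := sqr_ge0 eps; lra.
Qed.

End moments.

Lemma estimator_unit_interval :
  [/\ (\int[P]_w (mu_hat X eps w)%:E = (dmean D)%:E)%E,
      (\int[P]_w ((mu_hat X eps w - dmean D) ^+ 2)%:E
         <= ((Num.sqrt (258 / 100) * eps) ^+ 2)%:E)%E &
      eps < 1 -> (\int[P]_w (eps^-1 + T2 X eps w)%:E
         = (5 * dvar D / eps ^+ 2 + 2 / eps)%:E)%E].
Proof.
have [K NK] := N2_bounded.
(* The claims concern extended-real integrals and the computations real ones; integrability makes
   the two agree. *)
have toR m f : bounded_history P X m f -> (\int[P]_w (f w)%:E = (\int[P]_w f w)%R%:E)%E.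
  move=> bf; rewrite /Rintegral fineK//.
  by apply: integrable_fin_num => //; exact: bounded_history_integrable bf.
have bB := bounded_mu_hatB K NK.
have bmu : bounded_history P X (n + K) (mu_hat X eps).
  rewrite [Z in bounded_history _ _ _ Z](_ : _ = fun w => (mu_hat X eps w - mu) + mu).
    by apply: bounded_historyD => //; exact: bounded_history_cst.
  by apply/funext => w; rewrite subrK.
split.
- rewrite (toR _ _ bmu); congr EFin.
  transitivity (\int[P]_w (mu + 1 * (mu_hat X eps w - mu))).
    by apply: eq_Rintegral => w _; ring.
  rewrite (Rintegral_lin P X (n + K))//; last exact: bounded_history_cst.
  by rewrite Rintegral_cstT (Rintegral_mu_hatB K)// mulr0 addr0.
- rewrite (toR _ _ (bounded_history_sqr _ _ bB)) lee_fin exprMn sqr_sqrtr//.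
  exact: Rintegral_mu_hatB_sqr NK.
- move=> e1; have bc := bounded_history_cst P X n.
  rewrite (toR _ _ (bounded_historyD _ _ _ _ _ (bc eps^-1) bounded_T2)); congr EFin.
  transitivity (\int[P]_w (2 / eps + (5 / eps ^+ 2) * S w)).
    by apply: eq_Rintegral => w _; rewrite /T2; field; rewrite gt_eqF.
  rewrite (Rintegral_lin P X n)//; last exact: bounded_sigma_tilde2.
  by rewrite Rintegral_cstT Rintegral_sigma_tilde2//; field; rewrite gt_eqF.
Qed.

End sample_size.

End unit_interval_samples.

(** * Reduction to samples in the unit interval by clipping *)

Section clipping.
Context {R : realType} {d : measure_display} {T : measurableType d}.
Variable P : probability T R.

Definition clip01 (x : R) := Num.max 0 (Num.min 1 x).

Lemma clip01_itv x : 0 <= clip01 x <= 1.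
Proof. by rewrite /clip01 le_max lexx/= ge_max ler01 ge_min lexx. Qed.

Lemma clip01_id x : 0 <= x <= 1 -> clip01 x = x.
Proof. by move=> /andP[x0 x1]; rewrite /clip01 min_r// max_r. Qed.

Lemma measurable_clip01 : measurable_fun setT clip01.
Proof.
apply: measurable_maxr; first exact: measurable_cst.
by apply: measurable_minr; [exact: measurable_cst|exact: measurable_id].
Qed.

(** The complement of the unit interval is a null set of [D], and on the interval clipping is the
    identity, so the two events have the same trace there. *)
Lemma supported01_clip (D : probability R R) (A : set R) : supported01 D ->
  measurable A -> D (clip01 @^-1` A) = D A.
Proof.
move=> D01 mA; set I : set R := [set` `[0, 1]%R].
have mI : measurable I by exact: measurable_itv.
have mC : measurable (clip01 @^-1` A).
  by rewrite -[X in measurable X]setTI; exact: measurable_clip01.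
have D0 : D (~` I) = 0%E.
  by rewrite probability_setC// [X in (_ - X)%E]D01 subee.
have restrict B : measurable B -> D B = D (B `&` I).
  move=> mB; rewrite -{1}(setUIDK B I) measureU0//.
  - exact: measurableI.
  - exact: measurableD.
  - apply: (@subset_measure0 _ _ _ _ _ (~` I)).
    + exact: measurableD.
    + exact: measurableC.
    + by move=> x [].
    + exact: D0.
rewrite restrict// [RHS]restrict//; congr (D _).
apply/seteqP; split=> x [Ax Ix]; split=> //; move: Ax Ix;
  by rewrite /I /= in_itv/= => + /clip01_id xE; rewrite xE.
Qed.

Lemma measurable_clip01_comp (Z : {RV P >-> R}) :
  measurable_fun setT (clip01 \o Z).
Proof. by apply: measurableT_comp => //; exact: measurable_clip01. Qed.

Definition clipped (Z : {RV P >-> R}) : {RV P >-> R} :=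
  HB.pack (clip01 \o Z) (isMeasurableFun.Build _ _ _ _ _ (measurable_clip01_comp Z)).

Variables (X : nat -> {RV P >-> R}) (D : probability R R) (eps : R).

Lemma clipped_iid : supported01 D -> iid_with_law X D ->
  iid_with_law (fun i => clipped (X i)) D.
Proof.
have mC B : measurable B -> measurable (clip01 @^-1` B).
  by move=> mB; rewrite -[Z in measurable Z]setTI; exact: measurable_clip01.
move=> D01 [indX lawX]; split=> [m B mB|i A mA].
  exact: (indX m (fun i => clip01 @^-1` B i) (fun i => mC _ (mB i))).
rewrite -[RHS]supported01_clip// -(lawX i)//; exact: mC.
Qed.

Lemma ae_in_unit_interval : supported01 D -> iid_with_law X D ->
  {ae P, forall w, forall i, 0 <= X i w <= 1}.
Proof.
move=> D01 [_ lawX]; apply: ae_foralln => i; set I : set R := [set` `[0, 1]%R].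
have mI : measurable I by exact: measurable_itv.
have mX : measurable (X i @^-1` I).
  by rewrite -[Z in measurable Z]setTI; exact: measurable_funPT.
have P0 : P (~` (X i @^-1` I)) = 0%E.
  by rewrite probability_setC// lawX// [Z in (_ - Z)%E]D01 subee.
exists (~` (X i @^-1` I)); split.
- exact: measurableC.
- exact: P0.
- by move=> w /=; apply: contra_not => /=; rewrite /I /= in_itv.
Qed.

Lemma measurable_sample_mean (m k : nat) (c : R) :
  measurable_fun setT (fun w => (\sum_(i < k) X (m + i) w) / c).
Proof.
apply: measurable_funM; last exact: measurable_cst.
by apply: measurable_sum => i; exact: measurable_funPT.
Qed.

Lemma measurable_T2 : measurable_fun setT (T2 X eps).
Proof.
apply: measurable_funD; first exact: measurable_cst.
apply: measurable_funM; last exact: measurable_cst.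
apply: measurable_funM; first exact: measurable_cst.
apply: measurable_funM; last exact: measurable_cst.
apply: measurable_sum => i; apply: measurable_funX.
apply: measurable_funB; first exact: measurable_funPT.
exact: (measurable_sample_mean 0).
Qed.

(** The number of summands is random, so the preimage is cut into countably many pieces according to
    the value of [N2]; on each piece the estimator is a mean of a fixed number of samples. Samples
    are not confined to the unit interval here, and [N2] may be unbounded. *)
Lemma measurable_mu_hat : 0 < eps -> measurable_fun setT (mu_hat X eps).
Proof.
move=> eps_gt0 _ B mB; rewrite setTI.
rewrite (_ : _ @^-1` _ = \bigcup_k
  ((fun w => size_indicator k (T2 X eps w)) @^-1` [set 1] `&`
   (fun w => (\sum_(i < k) X (T1 eps + i)%N w) / k%:R) @^-1` B)).
  apply: bigcupT_measurable => k; apply: measurableI.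
    rewrite -[Z in measurable Z]setTI.
    have : measurable_fun setT (size_indicator k \o T2 X eps).
      apply: measurableT_comp; last exact: measurable_T2.
      by apply: measurable_indic; exact: measurable_itv.
    by apply => //; exact: measurable_set1.
  by rewrite -[Z in measurable Z]setTI; exact: measurable_sample_mean.
apply/seteqP; split=> [w Bw|w [k _ []]].
  by exists (N2 X eps w) => //; split=> //=; rewrite size_indicatorE// eqxx.
rewrite /= size_indicatorE//; case: eqP => [<-//|_ /esym/eqP].
by rewrite oner_eq0.
Qed.

End clipping.

Theorem theoremB2 (R : realType) (d : measure_display) (T : measurableType d)
  (P : probability T R) (D : probability R R) (X : nat -> {RV P >-> R})
  (eps : R) :
  supported01 D -> iid_with_law X D -> 0 < eps ->
  (* unbiased *)
  (\int[P]_w (mu_hat X eps w)%:E = (dmean D)%:E)%E /\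
  (* root mean squared error at most sqrt(2.58) eps *)
  (\int[P]_w ((mu_hat X eps w - dmean D) ^+ 2)%:E
     <= ((Num.sqrt (258 / 100) * eps) ^+ 2)%:E)%E /\
  (* expected number of samples (rounding ignored: T1 = 1/eps, T2 real) *)
  (eps < 1 ->
   (\int[P]_w (eps^-1 + T2 X eps w)%:E
     = (5 * dvar D / eps ^+ 2 + 2 / eps)%:E)%E).
Proof.
(* The clipped samples are again i.i.d. with law [D] and lie in the unit interval at every point, so
   all three claims hold for them. *)
move=> D01 iidX eps_gt0; pose X' i := clipped P (X i).
have [E1 E2 E3] := estimator_unit_interval P X' D (clipped_iid P X D D01 iidX)
  (fun i w => clip01_itv (X i w)) eps eps_gt0.
have X'E w : (forall i, 0 <= X i w <= 1) -> (fun i => X' i w) = (fun i => X i w).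
  by move=> X01; apply/funext => i; exact: clip01_id.
have T2E w : (forall i, 0 <= X i w <= 1) -> T2 X eps w = T2 X' eps w.
  move=> /X'E XE; rewrite /T2 /sigma_tilde2 /mu_tilde.
  have {}XE i : X' i w = X i w := congr1 (@^~ i) XE.
  under [in RHS]eq_bigr => i _.
    rewrite XE; under eq_bigr do rewrite XE. over.
  by [].
have hatE w : (forall i, 0 <= X i w <= 1) -> mu_hat X eps w = mu_hat X' eps w.
  move=> X01; rewrite /mu_hat /N2 T2E//.
  congr (_ / _); apply: eq_bigr => i _.
  by rewrite -(congr1 (@^~ (T1 eps + i)%N) (X'E w X01)).
(* Almost surely all the countably many samples lie in the unit interval at once; quantities that
   agree there have equal integrals once both are measurable. *)
have aeE (f g : T -> R) : measurable_fun setT f -> measurable_fun setT g ->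
    (forall w, (forall i, 0 <= X i w <= 1) -> f w = g w) ->
    (\int[P]_w (f w)%:E = \int[P]_w (g w)%:E)%E.
  move=> mf mg fg; apply: ae_eq_integral => //.
  - exact/measurable_EFinP.
  - exact/measurable_EFinP.
  - by apply: filterS (ae_in_unit_interval P X D D01 iidX) => w X01 _; rewrite fg.
have mh := measurable_mu_hat P X eps eps_gt0.
have mh' := measurable_mu_hat P X' eps eps_gt0.
split; [|split].
- by rewrite (aeE _ _ mh mh' hatE).
- rewrite (aeE _ (fun w => (mu_hat X' eps w - dmean D) ^+ 2))//.
  + by apply: measurable_funX; apply: measurable_funB => //; exact: measurable_cst.
  + by apply: measurable_funX; apply: measurable_funB => //; exact: measurable_cst.
  + by move=> w /hatE ->.
- move=> /E3 <-; apply: aeE.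
  + by apply: measurable_funD; [exact: measurable_cst|exact: measurable_T2].
  + by apply: measurable_funD; [exact: measurable_cst|exact: measurable_T2].
  + by move=> w /T2E ->.
Qed.
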